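(* Let $F$ be a finitely generated group with infinitely many ends, and let $P$ be a finitely generated subsemigroup of $F$. If $P P^{-1} = F$, then $P = F$.
   Context: A subsemigroup $P$ of a group $F$ is a non-empty subset closed under multiplication (it need not contain the identity); it is finitely generated if there is a finite subset of $P$ such that every element of $P$ is a product of a positive number of elements of that subset. Notation: $P^{-1} = \{p^{-1} \mid p \in P\}$ and $P P^{-1} = \{p q^{-1} \mid p, q \in P\}$. The number of ends of a finitely generated group is the number of ends of its Cayley graph with respect to any finite generating set. *)

(* Defs.v *)
From mathcomp Require Import all_boot.
From mathcomp Require Import boolp classical_sets functions cardinality.

Set Implicit Arguments.
Unset Strict Implicit.
Unset Printing Implicit Defensive.

Local Open Scope classical_set_scope.
Local Open Scope group_scope.

Section GraphEnds.
Variables (V : eqType) (e : rel V).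

(* [x] and [y] lie in the same connected component of the graph obtained by
   deleting the vertices in [K]; the relation [e] is meant to be symmetric. *)
Definition connected_off (K : seq V) (x y : V) : Prop :=
  exists p : seq V,
    [/\ path e x p, last x p = y & all [predC K] (x :: p)].

Definition ray (r : nat -> V) : Prop :=
  injective r /\ forall n, e (r n) (r n.+1).

(* After deleting any finite set of vertices, [r] and [s] have tails in the
   same component. *)
Definition ray_equiv (r s : nat -> V) : Prop :=
  forall K : seq V, exists N : nat,
    forall m n, N <= m -> N <= n -> connected_off K (r m) (s n).

Definition ends : set (set (nat -> V)) :=
  [set E | exists2 r, ray r & E = [set s | ray s /\ ray_equiv r s]].

End GraphEnds.

Section Groups.
Variable F : groupType.

Definition generating (S : seq F) : Prop :=
  smallest (fun H : set F => group_closed [in H]) [set` S] = [set: F].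

Definition finitely_generated : Prop := exists S : seq F, generating S.

Definition cayley_graph (S : seq F) : rel F :=
  [rel x y | (x^-1 * y \in S) || (y^-1 * x \in S)].

(* The number of ends does not depend on the finite generating set, so a
   single witness is required. *)
Definition infinitely_many_ends : Prop :=
  exists2 S : seq F, generating S & infinite_set (ends (cayley_graph S)).

Definition subsemigroup (P : set F) : Prop :=
  P !=set0 /\ mulg_closed [in P].

Definition fg_subsemigroup (P : set F) : Prop :=
  subsemigroup P /\
  exists A : seq F, [set` A] `<=` P /\
    forall x, P x ->
      exists s : seq F,
        [/\ s != [::], {subset s <= A} & x = \prod_(a <- s) a].

End Groups.

(* Main.v *)
Require Import Defs.
From mathcomp Require Import all_boot.
From mathcomp Require Import boolp classical_sets functions cardinality.
From mathcomp Require Import zify.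

Set Implicit Arguments.
Unset Strict Implicit.
Unset Printing Implicit Defensive.

Local Open Scope classical_set_scope.
Local Open Scope group_scope.

(** Write [x -> y] when [x^-1 * y] lies in [P]; the hypothesis [P P^-1 = F] says
that any two elements of [F] have a common successor, and iterating, so does
any finite set ([common_multiple]).  If some [w] is a successor of every [x],
then [P = F] ([setT_of_common_multiple]), so call [x] bad when [x -> w] fails.

Three pairwise inequivalent rays give three disjoint infinite sets that are
almost invariant: right translation by any element moves only finitely many
points out of them ([three_almost_invariant]).  Their boundaries in the Cayley
graph of the generators of [P] are finite; take [w] to be a common successor
of these boundaries.  A positive path that leaves one of the sets crosses its
boundary, so the whole cone [x P] of a bad point [x] stays in the set that
contains [x].  As any two cones meet, at most one of the sets contains bad
points ([bad_in_one_part]).  Let [X] and [Y] be two sets without bad points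
and [H] their union.

Let [K] be a finite set that contains [1], [w] and the relevant boundaries.
Almost invariance puts [g K] on one side of [H] for all but finitely many [g],
and likewise for [g^-1 K].  When two sets avoid each other's boundaries, they
are disjoint or both equal to [F] ([nested]); this is what turns the position
of the finite sets [g K] and [g^-1 K] into inclusions between half-spaces.

- If [g K] and [g^-1 K] both lie in [H] for some [g], then [g H] contains the
  complement of [H], so each [x] outside [H] satisfies [x -> g w -> w], and
  [w] is a successor of every element.
- Otherwise let [D] be the set of [g] with [g K] in [H] and [g^-1 K] outside
  [H].  It differs from [H] by a finite set, hence is almost invariant; since
  [g H] is included in [H] for [g] in [D], it is a subsemigroup without [1].
  Choosing [g] in [D] far out in [X] and [h] in [D] far out in [Y], one gets
  [g H] in [X] and [h H] in [Y].  So [g] and [h] generate a free semigroup, and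
  [no_branching] refutes this by counting.  For a suitable word [u] of length
  [n], every word [v] of length [n] leaves [D] while it is divided by the
  letters of [u] one after the other.  The step and the boundary point of [D]
  at which this happens determine [v], so there are only linearly many [v] in
  terms of [n], whereas there are [2 ^ n] words.
*)

(** * Components that contain the tail of a ray *)

Section RayComponents.
Context {V : eqType} {e : rel V}.
Hypothesis e_sym : symmetric e.
Implicit Types (K : seq V) (r s : nat -> V).

Lemma connected_off_sym K x y : connected_off e K x y -> connected_off e K y x.
Proof.
move=> [p [ep lp ap]]; exists (rev (belast x p)); split.
- rewrite -lp rev_path.
  by rewrite (eq_path (e' := e)) // => a b; rewrite /= e_sym.
- by case: p {ep ap} lp => [|a p] //= _; rewrite rev_cons last_rcons.
- by rewrite -lp -rev_rcons -lastI all_rev.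
Qed.

Lemma connected_off_trans K y x z :
  connected_off e K x y -> connected_off e K y z -> connected_off e K x z.
Proof.
move=> [p [ep lp ap]] [q [eq lq /= /andP[_ aq]]]; exists (p ++ q); split.
- by rewrite cat_path ep lp.
- by rewrite last_cat lp.
- by rewrite -cat_cons all_cat ap.
Qed.

Lemma connected_off_sub K K' x y : {subset K <= K'} ->
  connected_off e K' x y -> connected_off e K x y.
Proof.
move=> sKK' [p [ep lp ap]]; exists p; split=> //.
by apply: sub_all ap => z; apply/contra/sKK'.
Qed.

Lemma connected_off_notinl K x y : connected_off e K x y -> x \notin K.
Proof. by move=> [p [_ _ /andP[]]]. Qed.

Lemma ray_equiv_sym r s : ray_equiv e r s -> ray_equiv e s r.
Proof.
move=> rs K; have [N rsN] := rs K; exists N => m n Nm Nn.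
exact/connected_off_sym/rsN.
Qed.

Lemma ray_equiv_trans s r t :
  ray_equiv e r s -> ray_equiv e s t -> ray_equiv e r t.
Proof.
move=> rs st K; have [N rsN] := rs K; have [M stM] := st K.
exists (maxn N M) => m n Nm Mn; rewrite !geq_max in Nm Mn.
case/andP: Nm Mn => [Nm _] /andP[_ Mn].
apply: connected_off_trans (stM (maxn N M) n (leq_maxr _ _) Mn).
exact/rsN/leq_maxl.
Qed.

Definition tails_joined K r s := exists N : nat,
  forall m n, N <= m -> N <= n -> connected_off e K (r m) (s n).

(** An end is an equivalence class of rays, so two different ends are
represented by inequivalent rays. *)
Lemma distinct_ends_separated r s :
  [set t | ray e t /\ ray_equiv e r t] <>
    [set t | ray e t /\ ray_equiv e s t] ->
  exists K, ~ tails_joined K r s.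
Proof.
move=> neq; apply/existsNP => rs; apply: neq.
by apply/seteqP; split=> t [t_ray tr]; split=> //;
  apply: ray_equiv_trans tr => //; apply: ray_equiv_sym.
Qed.

Lemma separated_sub K K' r s : {subset K <= K'} ->
  ~ tails_joined K r s -> ~ tails_joined K' r s.
Proof.
move=> sKK' nrs [N rsN]; apply: nrs; exists N => m n Nm Nn.
exact/(connected_off_sub sKK')/rsN.
Qed.

(** A single finite set separates all three pairs, because enlarging the set of
deleted vertices preserves separation. *)
Lemma three_separated_rays : infinite_set (ends e) ->
  exists r0 r1 r2 K, [/\ ray e r0, ray e r1 & ray e r2] /\
    [/\ ~ tails_joined K r0 r1, ~ tails_joined K r0 r2
      & ~ tails_joined K r1 r2].
Proof.
move=> infE.
have [E0 [r0 ray0 defE0]] := infinite_setN0 infE.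
have /infinite_setN0[E1 [[r1 ray1 defE1] /= E1n0]] :=
  infinite_setD infE (finite_set1 E0).
have /infinite_setN0[E2 [[r2 ray2 defE2] /= E2n]] :=
  infinite_setD infE (finite_set2 E0 E1).
have [K1 sep1] : exists K, ~ tails_joined K r0 r1.
  by apply: distinct_ends_separated => eq; apply: E1n0; rewrite defE1 defE0.
have [K2 sep2] : exists K, ~ tails_joined K r0 r2.
  apply: distinct_ends_separated => eq; apply: E2n; left.
  by rewrite defE2 defE0.
have [K3 sep3] : exists K, ~ tails_joined K r1 r2.
  apply: distinct_ends_separated => eq; apply: E2n; right.
  by rewrite defE2 defE1.
exists r0, r1, r2, (K1 ++ K2 ++ K3); split=> //.
split; [apply: separated_sub sep1 | apply: separated_sub sep2
       | apply: separated_sub sep3] => x xK; rewrite !mem_cat xK ?orbT //.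
Qed.

Lemma injective_leaves_finite {T : eqType} (r : nat -> T) (K : seq T) :
  injective r -> exists N, forall n, N <= n -> r n \notin K.
Proof.
move=> injr; elim: K => [|x K [N rN]]; first by exists 0.
have [[n rn]|nx] := pselect (exists n, r n = x).
  exists (maxn N n.+1) => m; rewrite geq_max => /andP[Nm nm].
  rewrite in_cons negb_or rN // andbT -rn; apply/eqP => /injr mn.
  by rewrite mn ltnn in nm.
exists N => n Nn; rewrite in_cons negb_or rN // andbT.
by apply/eqP => rn; apply: nx; exists n.
Qed.

(** The component of the complement of [K] in which the ray [r] ends up. *)
Definition ray_side K r : set V :=
  [set x | exists N, forall n, N <= n -> connected_off e K x (r n)].

Lemma ray_side_step K r x y :
  ray_side K r x -> e x y -> y \notin K -> ray_side K r y.
Proof.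
move=> [N rN] exy yK; exists N => n Nn.
apply: connected_off_trans (rN n Nn); exists [:: x]; split=> //=.
  by rewrite e_sym exy.
by rewrite yK (connected_off_notinl (rN n Nn)).
Qed.

Lemma ray_side_infinite K r : ray e r -> infinite_set (ray_side K r).
Proof.
move=> [injr er]; have [N rN] := injective_leaves_finite K injr.
have tail m : N <= m -> ray_side K r (r m).
  move=> Nm; exists m => n mn; rewrite -(subnKC mn).
  elim: (n - m)%N => [|k IH].
    by exists [::]; rewrite /= addn0 rN.
  apply: connected_off_trans IH _; exists [:: r (m + k.+1)%N]; split=> //=.
    by rewrite addnS er.
  by rewrite !rN //; lia.
case/finite_seqP => s sE; have [M rM] := injective_leaves_finite s injr.
have : ray_side K r (r (maxn N M)) by apply/tail/leq_maxl.
by rewrite sE /= => rs; move: (rM _ (leq_maxr N M)); rewrite rs.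
Qed.

Lemma ray_side_disjoint K r s : ~ tails_joined K r s ->
  forall x, ray_side K r x -> ~ ray_side K s x.
Proof.
move=> nrs x [N rN] [M sM]; apply: nrs; exists (maxn N M) => m n.
rewrite !geq_max => /andP[Nm _] /andP[_ Mn].
by apply: connected_off_trans (sM n Mn); apply/connected_off_sym/rN.
Qed.

End RayComponents.

(** * Almost invariant subsets of a group *)

Section AlmostInvariant.
Context {F : groupType}.
Implicit Types (X Y Z K : set F) (f g x y : F).

(** Quantifying over all [f], rather than over a generating set, makes the
notion independent of generators: the ends are seen through one generating set
of the group, the semigroup [P] through another. *)
Definition almost_invariant Y :=
  forall f, finite_set [set y | Y y /\ ~ Y (y * f)].

(** The elements [f] such that right translation by [f] and by [f^-1] move only
finitely many points out of [Y] form a subgroup. *)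
Lemma almost_invariant_generating (S : seq F) Y : generating S ->
  (forall s, s \in S -> finite_set [set y | Y y /\ ~ Y (y * s)] /\
                        finite_set [set y | Y y /\ ~ Y (y * s^-1)]) ->
  almost_invariant Y.
Proof.
move=> genS finS f.
pose fin f := finite_set [set y | Y y /\ ~ Y (y * f)].
have fin_div x y : fin x -> fin y^-1 -> fin (x / y).
  move=> fx fy; apply: (@sub_finite_set _ _ ([set z | Y z /\ ~ Y (z * x)] `|`
    (fun z => z / x) @` [set z | Y z /\ ~ Y (z / y)])).
    move=> z [Yz nYz]; have [Yzx|] := pselect (Y (z * x)); last by left.
    right; exists (z * x); last by rewrite mulgK.
    by split=> //; rewrite -mulgA.
  by rewrite finite_setU; split=> //; apply: finite_image.
suff [] : [set f | fin f /\ fin f^-1] f by [].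
have : [set: F] f by []; rewrite -genS.
apply: smallest_sub => [|s Ss]; last exact: finS.
split.
  rewrite inE /= invg1; suff f1 : fin 1 by [].
  by apply: sub_finite_set (finite_set0 F) => y [Yy]; rewrite mulg1.
move=> x y; rewrite !inE /= => -[fx fx'] [fy fy']; split; first exact: fin_div.
by rewrite invgF; apply: fin_div.
Qed.

Lemma almost_invariantC Y : almost_invariant Y -> almost_invariant (~` Y).
Proof.
move=> aiY f; apply: sub_finite_set (finite_image (fun z => z / f) (aiY f^-1)).
move=> y [nYy /contrapT Yyf]; exists (y * f); last by rewrite mulgK.
by rewrite /= mulgK.
Qed.

Lemma almost_invariantU X Y :
  almost_invariant X -> almost_invariant Y -> almost_invariant (X `|` Y).
Proof.
move=> aiX aiY f.
apply: (@sub_finite_set _ _ ([set y | X y /\ ~ X (y * f)] `|`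
                             [set y | Y y /\ ~ Y (y * f)])).
  by move=> y [[Xy|Yy] nXY]; [left|right]; split=> // ?; apply: nXY;
    [left|right].
by rewrite finite_setU.
Qed.

Lemma almost_invariant_finiteD X Y : X `<=` Y -> finite_set (Y `\` X) ->
  almost_invariant Y -> almost_invariant X.
Proof.
move=> sXY finD aiY f.
apply: (@sub_finite_set _ _ ([set y | Y y /\ ~ Y (y * f)] `|`
                             (fun z => z / f) @` (Y `\` X))).
  move=> y [Xy nXyf]; have [Yyf|nYyf] := pselect (Y (y * f)).
    by right; exists (y * f); rewrite ?mulgK.
  by left; split=> //; apply: sXY.
by rewrite finite_setU; split=> //; apply: finite_image.
Qed.

(** For [y] in [Y] outside a finite set, the whole translate [y K] lies in [Y]. *)
Lemma almost_invariant_translate K Y : finite_set K -> almost_invariant Y ->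
  finite_set [set y | Y y /\ exists2 k, K k & ~ Y (y * k)].
Proof.
move=> finK aiY; apply: sub_finite_set (bigcup_finite finK (fun k _ => aiY k)).
by move=> y [Yy [k Kk nYyk]]; exists k.
Qed.

(** The components of three pairwise separated rays, off a finite set [K]: an
edge can leave such a component only by entering [K]. *)
Lemma three_almost_invariant : infinitely_many_ends F ->
  exists X0 X1 X2 : set F,
    [/\ almost_invariant X0, almost_invariant X1 & almost_invariant X2] /\
    [/\ infinite_set X0, infinite_set X1 & infinite_set X2] /\
    [/\ forall x, X0 x -> ~ X1 x, forall x, X0 x -> ~ X2 x
      & forall x, X1 x -> ~ X2 x].
Proof.
move=> [S genS infE].
have e_sym : symmetric (cayley_graph S).
  by move=> x y; rewrite /cayley_graph /= orbC.
have [r0 [r1 [r2 [K [[ray0 ray1 ray2] [sep01 sep02 sep12]]]]]] :=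
  three_separated_rays e_sym infE.
have ai r : almost_invariant (@ray_side _ (cayley_graph S) K r).
  apply: almost_invariant_generating genS _ => s Ss.
  have fin f : (forall y, cayley_graph S y (y * f)) ->
    finite_set [set y | @ray_side _ (cayley_graph S) K r y /\
                        ~ @ray_side _ (cayley_graph S) K r (y * f)].
    move=> ef; apply: sub_finite_set
      (finite_image (fun z => z / f) (finite_seq K)) => y [ry nry].
    exists (y * f); last by rewrite mulgK.
    by apply/negPn/negP => yfK; apply: nry; apply: ray_side_step ry _ yfK.
  split; apply: fin => y; rewrite /cayley_graph /=.
    by rewrite mulKg Ss.
  by rewrite invgM invgK mulgVK Ss orbT.
exists (@ray_side _ (cayley_graph S) K r0), (@ray_side _ (cayley_graph S) K r1),
  (@ray_side _ (cayley_graph S) K r2).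
split; first by split; apply: ai.
split; first by split; apply: ray_side_infinite.
by split; apply: ray_side_disjoint.
Qed.

End AlmostInvariant.

(** * Subsemigroups with finite boundary do not branch *)

Section NoBranching.
Context {F : groupType} (D : set F) (g h : F).
Hypotheses (D_mul : forall x y, D x -> D y -> D (x * y)) (D_1 : ~ D 1).

(** The relation [D (v / u)] is a strict order on [F], as [D] is a subsemigroup
without [1]; so finite sets have maximal elements for it. *)
Lemma maximal_in_seq (s : seq F) : s != [::] ->
  exists2 u, u \in s & forall v, v \in s -> ~ D (v / u).
Proof.
elim: s => // x [|y s] IH _.
  by exists x; rewrite ?mem_head // => v; rewrite inE => /eqP ->; rewrite mulgV.
have [//|m ms m_max] := IH.
have [Dxm|nDxm] := pselect (D (x / m)).
  exists x; rewrite ?mem_head // => v; rewrite inE => /predU1P[->|vs].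
    by rewrite mulgV.
  move=> Dvx; apply: (m_max v vs); have := D_mul Dvx Dxm.
  by rewrite mulgA mulgVK.
exists m; first by rewrite inE ms orbT.
by move=> v; rewrite inE => /predU1P[->|/m_max].
Qed.

Definition letter (b : bool) := if b then g else h.

(** Words end in [g] rather than in [1], so that all their values lie in [D]. *)
Definition word (s : seq bool) : F := foldr (fun b x => letter b * x) g s.

(** The values of the proper suffixes of the product [word s].  Read from the
end, their inverses form a path that starts at [1] and whose steps are right
multiplications by [g^-1] or [h^-1]. *)
Fixpoint suffixes (s : seq bool) : seq F :=
  if s is _ :: t then word t :: suffixes t else [:: 1].

Lemma size_suffixes s : size (suffixes s) = (size s).+1.
Proof. by elim: s => //= b s ->. Qed.

Hypotheses (D_g : D g) (D_h : D h).

Lemma D_word s : D (word s).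
Proof. by elim: s => //= b s IH; apply: D_mul => //; case: b. Qed.

Hypothesis D_disjoint : forall x y, D x -> D y -> g * x <> h * y.

Lemma word_inj s t : size s = size t -> word s = word t -> s = t.
Proof.
elim: s t => [|b s IH] [|c t] //= [eqs].
have [<- /mulgI /IH -> //|nbc] := eqVneq b c.
case: b c nbc => [] [] // _ eqw; exfalso.
  exact: D_disjoint (D_word s) (D_word t) eqw.
exact: D_disjoint (D_word t) (D_word s) (esym eqw).
Qed.

(** The path [v, v / g, ..., v / word s] starts in [D] and ends outside [D], so
one of its steps, of the form [/ g] or [/ h], leaves [D]. *)
Lemma leaves_at_suffix (v : F) s : D v -> ~ D (v / word s) ->
  exists2 u, u \in suffixes s &
    D (v / u) /\ (~ D (v / u / g) \/ ~ D (v / u / h)).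
Proof.
move=> Dv; elim: s => [|b s IH] /= nD.
  by exists 1; rewrite ?mem_head // invg1 mulg1; split=> //; left.
have [Dvs|/IH[u us uP]] := pselect (D (v / word s)); last first.
  by exists u; rewrite // inE us orbT.
exists (word s); rewrite ?mem_head //; split=> //.
by rewrite invgM mulgA in nD; case: b nD; [left|right].
Qed.

Hypotheses (D_bd_g : finite_set [set y | D y /\ ~ D (y / g)])
           (D_bd_h : finite_set [set y | D y /\ ~ D (y / h)]).

(** Take [word t] maximal among the [2 ^ n] words of length [n].  For each such
word [v], [v / word t] is outside [D], so by [leaves_at_suffix] [v] is the
product of a point of the finite boundary [E] and one of the [n + 1] suffixes
of [t].  Hence [2 ^ n <= #|E| * (n + 1)] for all [n], which is absurd. *)
Lemma no_branching : False.
Proof.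
have /finite_seqP[E defE] : finite_set ([set y | D y /\ ~ D (y / g)] `|`
                                        [set y | D y /\ ~ D (y / h)]).
  by rewrite finite_setU.
have bound n : 2 ^ n <= size E * n.+1.
  pose W := [seq word (tval t) | t : n.-tuple bool].
  have W_uniq : uniq W.
    rewrite map_inj_in_uniq ?enum_uniq // => s t _ _ /word_inj st.
    by apply/val_inj/st; rewrite !size_tuple.
  have W_size : size W = (2 ^ n)%N.
    by rewrite size_map -cardE card_tuple card_bool.
  have [|_ /mapP[t _ ->] t_max] := @maximal_in_seq W.
    by rewrite -size_eq0 W_size expn_eq0.
  rewrite -W_size -[n in (n.+1)](size_tuple t) -size_suffixes.
  rewrite -(size_allpairs *%g).
  apply: uniq_leq_size W_uniq _ => v vW.
  have Dv : D v by case/mapP: vW => s _ ->; apply: D_word.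
  have [u us [Dvu out]] := leaves_at_suffix Dv (t_max v vW).
  rewrite -[v](mulgVK u); apply: allpairs_f us => //.
  by have : [set` E] (v / u) by rewrite -defE; case: out; [left|right].
(* With [m = 2 #|E|], the bound at [n = 2 m] contradicts [m < 2 ^ m]. *)
have := bound (size E * 2 * 2)%N; rewrite expnM -mulnn.
have := ltn_expl (size E * 2)%N (ltnSn 1).
by move: (size E) => b; set a := expn _ _; move: a => a; nia.
Qed.

End NoBranching.

(** * Nested translates and positive cones *)

Section Fractions.
Context {F : groupType} (P : set F) (A : seq F).
Hypotheses (P_mul : forall x y, P x -> P y -> P (x * y))
  (A_P : [set` A] `<=` P)
  (A_gen : forall x, P x -> exists s : seq F,
             [/\ s != [::], {subset s <= A} & x = \prod_(a <- s) a])
  (P_frac : forall x, exists p q, [/\ P p, P q & x = p / q]).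
Implicit Types (X Y Z K : set F) (f g x y : F).

(** The group is generated by [A], because [F = P P^-1] and [A] generates [P]. *)
Lemma stable_setT Z :
  (forall x a, a \in A -> Z x -> Z (x * a) /\ Z (x / a)) ->
  forall x y, Z x -> Z y.
Proof.
move=> ZA.
have Zprod s : {subset s <= A} -> forall x, Z x ->
    Z (x * \prod_(a <- s) a) /\ Z (x / \prod_(a <- s) a).
  elim: s => [|a s IH] sA x Zx; first by rewrite big_nil invg1 mulg1.
  have aA : a \in A by apply/sA/mem_head.
  have {}IH : forall x, Z x -> _ :=
    IH (fun b bs => sA b (mem_behead (s := a :: s) bs)).
  rewrite big_cons invgM !mulgA; split.
    by have [/IH[]] := ZA x a aA Zx.
  by have [_ /(ZA _ a aA)[]] := IH x Zx.
have ZP p : P p -> forall x, Z x -> Z (x * p) /\ Z (x / p).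
  by move=> /A_gen[s [_ sA ->]]; apply: Zprod.
move=> x y Zx; have [p [q [Pp Pq xy]]] := P_frac (x^-1 * y).
have -> : y = x * p / q by rewrite -mulgA -xy mulVKg.
by have [/(ZP q Pq)[]] := ZP p Pp x Zx.
Qed.

(** The inner vertex boundary in the Cayley graph with respect to [A]. *)
Definition boundary Y : set F :=
  [set y | Y y /\ exists2 a, a \in A & ~ Y (y * a) \/ ~ Y (y / a)].

Lemma finite_boundary Y : almost_invariant Y -> finite_set (boundary Y).
Proof.
move=> aiY.
pose B : set F := [set` A] `|` (fun z : F => z^-1) @` [set` A].
have finB : finite_set B.
  by rewrite finite_setU; split; [|apply: finite_image]; apply: finite_seq.
apply: sub_finite_set (almost_invariant_translate finB aiY).
move=> y [Yy [a aA out]]; split=> //.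
case: out => out; [exists a => //; left => // | exists a^-1 => //].
by right; exists a.
Qed.

(** An edge leaving the intersection of [Y] and [Z] starts in the boundary of
one of the two sets and in the interior of the other.  So here no edge leaves
it, and by connectedness it is empty or equal to [F]; the point [z] excludes
the latter. *)
Lemma nested Y Z : (forall x, boundary Y x -> ~ Z x) ->
  (forall x, boundary Z x -> ~ Y x) -> (exists z, ~ (Y z /\ Z z)) ->
  forall x, Y x -> ~ Z x.
Proof.
move=> bYZ bZY [z nz] x Yx Zx; apply: nz.
apply: (@stable_setT (Y `&` Z)) (conj Yx Zx) => {z Yx Zx}{}x a aA [Yx Zx].
split; split; apply: contrapT => out.
- by apply: (bYZ x) => //; split=> //; exists a; [|left].
- by apply: (bZY x) => //; split=> //; exists a; [|left].
- by apply: (bYZ x) => //; split=> //; exists a; [|right].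
- by apply: (bZY x) => //; split=> //; exists a; [|right].
Qed.

Definition translate g Y : set F := [set x | Y (g^-1 * x)].

Lemma boundary_translate g Y x :
  boundary (translate g Y) x -> boundary Y (g^-1 * x).
Proof.
by move=> [Yx [a aA out]]; split=> //; exists a => //; rewrite -!mulgA.
Qed.

(** A common successor is found one point at a time: successors of [w] of the
form [w * q] with [q] in [P] remain successors of the earlier points. *)
Lemma common_multiple K : finite_set K ->
  exists w, forall x, K x -> P (x^-1 * w).
Proof.
case/finite_seqP => s ->; elim: s => [|x s [w wP]]; first by exists 1.
have [p [q [Pp Pq xw]]] := P_frac (x^-1 * w).
exists (w * q) => y; rewrite /= inE => /predU1P[->|ys].
  by rewrite mulgA xw mulgVK.
by rewrite mulgA; apply/P_mul/Pq/wP.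
Qed.

Lemma setT_of_common_multiple w : (forall x, P (x^-1 * w)) -> P = [set: F].
Proof.
move=> wP; apply/seteqP; split=> // y _.
by have := wP (w / y); rewrite invgF mulgVK.
Qed.

(** A path of generators from [x] that leaves [X] would meet the boundary of
[X], from which [w] is reached, so [w] would be reached from [x]. *)
Lemma bad_cone_stays w X x p : (forall y, boundary X y -> P (y^-1 * w)) ->
  X x -> ~ P (x^-1 * w) -> P p -> X (x * p).
Proof.
move=> bdw Xx bad_x /A_gen[s [_ sA ->]].
elim: s x Xx bad_x sA => [|a s IH] x Xx bad_x sA;
  first by rewrite big_nil mulg1.
have aA : a \in A by apply/sA/mem_head.
rewrite big_cons mulgA; apply: IH; last by move=> b bs; apply/sA/mem_behead.
  apply: contrapT => nXxa; apply/bad_x/bdw.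
  by split=> //; exists a => //; left.
move=> Pxa; apply: bad_x; rewrite -[x^-1](mulKg a^-1) invgK -mulgA.
apply: P_mul; first exact: A_P.
by rewrite -invgM.
Qed.

(** The cones of [x] and [y] meet, so they cannot stay in disjoint sets. *)
Lemma bad_in_one_part w X Y x y :
  (forall z, boundary X z -> P (z^-1 * w)) ->
  (forall z, boundary Y z -> P (z^-1 * w)) ->
  (forall z, X z -> ~ Y z) -> X x -> Y y ->
  P (x^-1 * w) \/ P (y^-1 * w).
Proof.
move=> bdX bdY disj Xx Yy; apply: contrapT => /not_orP[bad_x bad_y].
have [p [q [Pp Pq xy]]] := P_frac (x^-1 * y).
have xp : x * p = y * q by rewrite -[p](mulgVK q) -xy mulgA mulVKg.
apply: (disj (x * p)); first exact: bad_cone_stays bdX _ _ _.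
by rewrite xp; apply: bad_cone_stays bdY _ _ _.
Qed.

(** With [H] the union of [X] and [Y]: either some translate [g H] covers the
complement of [H], and then [w] is reached from everywhere, through [g w] if
need be; or almost all [g] in [H] satisfy [g H <= H], and these form a
subsemigroup that [no_branching] excludes. *)
Lemma two_good_parts w X Y : almost_invariant X -> almost_invariant Y ->
  infinite_set X -> infinite_set Y -> (forall x, X x -> ~ Y x) ->
  (forall x, X x -> P (x^-1 * w)) -> (forall x, Y x -> P (x^-1 * w)) ->
  P = [set: F].
Proof.
move=> aiX aiY infX infY disj goodX goodY.
pose H := X `|` Y.
have aiH : almost_invariant H by apply: almost_invariantU.
have goodH x : H x -> P (x^-1 * w) by move=> [/goodX|/goodY].
pose K := [set 1; w] `|` (boundary H `|` boundary (~` H) `|`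
           (boundary (~` X) `|` boundary (~` Y))).
have finK : finite_set K.
  rewrite /K !finite_setU; do !split; try exact: finite_set1;
    by apply: finite_boundary => //; apply: almost_invariantC.
have K1 : K 1 by left; left.
have Kw : K w by left; right.
have KH x : boundary H x -> K x by right; left; left.
have KHC x : boundary (~` H) x -> K x by right; left; right.
have KXC x : boundary (~` X) x -> K x by right; right; left.
have KYC x : boundary (~` Y) x -> K x by right; right; right.
have [[g [gH gVH]]|no_g] := pselect (exists g,
    (forall k, K k -> H (g * k)) /\ (forall k, K k -> H (g^-1 * k))).
  (* The complements of [H] and of [g H] are disjoint by nesting. *)
  have out x : ~ H x -> H (g^-1 * x).
    move=> nHx; apply: contrapT => nHgx.
    apply: (@nested (translate g (~` H)) (~` H) _ _ _ x) => //.
    - by move=> y /boundary_translate/KHC/gH; rewrite mulVKg => Hy; apply.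
    - by move=> y /KHC/gVH Hy; apply.
    - by exists (g * 1) => -[_]; apply; apply: gH.
  apply: (@setT_of_common_multiple w) => x.
  have [/goodH //|/out/goodH] := pselect (H x).
  rewrite invgM invgK -mulgA => Pxgw.
  have := P_mul Pxgw (goodH _ (gH _ Kw)).
  by rewrite invgM !mulgA !mulgK.
exfalso.
pose D := [set g | (forall k, K k -> H (g * k)) /\
                   (forall k, K k -> ~ H (g^-1 * k))].
have D_H : D `<=` H by move=> g [/(_ 1 K1)]; rewrite mulg1.
(* Nesting of [g H] with the complement of [Z]: for [g] in [D], the position of
   the finite set [g K] alone decides whether [g H] lies in [Z]. *)
have maps_into Z g : D g -> (forall k, K k -> Z (g * k)) ->
    (forall x, boundary (~` Z) x -> K x) -> forall x, H x -> Z (g * x).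
  move=> [_ gVH] gZ KZ x Hx; apply: contrapT => nZgx.
  apply: (@nested (translate g H) (~` Z) _ _ _ (g * x)) => //.
  - by move=> y /boundary_translate/KH/gZ; rewrite mulVKg => Zy; apply.
  - by move=> y /KZ/gVH.
  - by exists (g * 1) => -[_]; apply; apply: gZ.
  - by rewrite /translate /= mulKg.
have D_mulH g x : D g -> H x -> H (g * x).
  by move=> Dg; apply: maps_into => //; apply: Dg.1.
have D_mul x y : D x -> D y -> D (x * y).
  move=> Dx Dy; split=> k Kk.
    by rewrite -mulgA; apply: D_mulH => //; apply: Dy.1.
  rewrite invgM -mulgA => /(D_mulH _ _ Dy); rewrite mulVKg.
  exact: Dx.2.
have D_1 : ~ D 1.
  by move=> [/(_ 1 K1) H1 /(_ 1 K1)]; rewrite invg1.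
(* For [x] in [H] outside [D], [x K] or [x^-1 K] meets both [H] and its
   complement, since [no_g] forbids that both lie in [H]. *)
have finHD : finite_set (H `\` D).
  have aiHC := almost_invariantC aiH.
  apply: (@sub_finite_set _ _ ([set y | H y /\ exists2 k, K k & ~ H (y * k)] `|`
    (fun z : F => z^-1) @` ([set y | H y /\ exists2 k, K k & ~ H (y * k)] `|`
    [set y | (~` H) y /\ exists2 k, K k & ~ (~` H) (y * k)]))).
    move=> x [Hx nDx].
    have [xH|/existsNP[k /not_implyP[Kk nHxk]]] :=
      pselect (forall k, K k -> H (x * k)); last by left; split=> //; exists k.
    right; exists x^-1; last by rewrite invgK.
    have [Hx'|nHx'] := pselect (H x^-1); [left|right]; split=> //.
      apply: contrapT => nk; apply: no_g; exists x; split=> // k Kk.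
      by apply: contrapT => nHk; apply: nk; exists k.
    apply: contrapT => nk; apply: nDx; split=> // k Kk Hk.
    by apply: nk; exists k => //; apply.
  by rewrite finite_setU; split; last (apply: finite_image;
    rewrite finite_setU; split); apply: almost_invariant_translate.
have aiD : almost_invariant D by apply: almost_invariant_finiteD finHD aiH.
(* All but finitely many [g] in [Z] lie in [D] and satisfy [g K] in [Z]. *)
have inD Z : Z `<=` H -> almost_invariant Z -> infinite_set Z ->
    exists2 g, D g & forall k, K k -> Z (g * k).
  move=> ZH aiZ infZ.
  have finZ : finite_set ([set y | Z y /\ exists2 k, K k & ~ Z (y * k)] `|`
                          (H `\` D)).
    by rewrite finite_setU; split=> //; apply: almost_invariant_translate.
  have [g [Zg ng]] := infinite_setN0 (infinite_setD infZ finZ).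
  exists g => [|k Kk]; apply: contrapT => nout; apply: ng.
    by right; split=> //; apply: ZH.
  by left; split=> //; exists k.
have [g Dg gX] := inD X (fun x => @or_introl _ _) aiX infX.
have [h Dh hY] := inD Y (fun x => @or_intror _ _) aiY infY.
apply: (@no_branching F D g h) => // x y Dx Dy eq_gh.
apply: (disj (g * x)); first by apply: maps_into => //; apply: D_H.
by rewrite eq_gh; apply: maps_into => //; apply: D_H.
Qed.

(** Among three disjoint sets at most one contains bad points, which leaves two
to which [two_good_parts] applies. *)
Lemma fractions_setT : infinitely_many_ends F -> P = [set: F].
Proof.
move=> /three_almost_invariant[X0 [X1 [X2 [[ai0 ai1 ai2]
  [[inf0 inf1 inf2] [dis01 dis02 dis12]]]]]].
have [w wP] : exists w, forall x,
    (boundary X0 `|` boundary X1 `|` boundary X2) x -> P (x^-1 * w).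
  by apply: common_multiple; rewrite !finite_setU; split; [split|];
    apply: finite_boundary.
have bd0 x : boundary X0 x -> P (x^-1 * w) by move=> bx; apply: wP; left; left.
have bd1 x : boundary X1 x -> P (x^-1 * w) by move=> bx; apply: wP; left; right.
have bd2 x : boundary X2 x -> P (x^-1 * w) by move=> bx; apply: wP; right.
pose good X := forall x, X x -> P (x^-1 * w).
have one_good X Y : (forall x, boundary X x -> P (x^-1 * w)) ->
    (forall x, boundary Y x -> P (x^-1 * w)) ->
    (forall x, X x -> ~ Y x) -> good X \/ good Y.
  move=> bdX bdY disj; apply: contrapT => /not_orP[].
  move=> /existsNP[x /not_implyP[Xx bad_x]] /existsNP[y /not_implyP[Yy bad_y]].
  by case: (bad_in_one_part bdX bdY disj Xx Yy).
have [g0|g1] := one_good X0 X1 bd0 bd1 dis01.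
  by have [g1|g2] := one_good X1 X2 bd1 bd2 dis12;
    [apply: (@two_good_parts w X0 X1) | apply: (@two_good_parts w X0 X2)].
by have [g0|g2] := one_good X0 X2 bd0 bd2 dis02;
  [apply: (@two_good_parts w X0 X1) | apply: (@two_good_parts w X1 X2)].
Qed.

End Fractions.

Theorem theorem2p3 (F : groupType) (P : set F) :
  finitely_generated F -> infinitely_many_ends F -> fg_subsemigroup P ->
  [set p * q^-1 | p in P & q in P] = [set: F] ->
  P = [set: F].
Proof.
move=> _ inf_ends [[_ P_mul] [A [A_P A_gen]]] P_frac.
apply: (@fractions_setT F P A) => //.
- by move=> x y Px Py; have := P_mul x y; rewrite !inE; apply.
- move=> x; have : [set: F] x by [].
  by rewrite -P_frac => -[p Pp [q Pq <-]]; exists p, q.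
Qed.
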